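(* Let $\mathcal C$ be a Cauchy complete $*$-autonomous category (not assumed symmetric) equipped with a right $\otimes$-trace and a left $\otimes$-trace, and let $⅋$, $\delta_L,\delta_R$, $\Phi$ and $\Phi'$ be the par tensor, the linear distributors, and the ''white Frobenius'' operation and its mirror image, as defined in the context. Suppose that the following equations hold for all objects $A_1,A_2,B_1,B_2,X,Y$ of $\mathcal C$: 1. for all $f\colon A_1\to B_1$, $h\colon A_2\to X\otimes Y$, $k\colon X\otimes Y\to B_2$, $$(\mathrm{id}_{B_1}⅋ k)\circ\delta_R\circ\Phi(f⅋\mathrm{id}_X,\,h)=f⅋(k\circ h)\colon A_1⅋ A_2\to B_1⅋ B_2;$$ 2. for all $f\colon A_1\to X⅋ Y$, $g\colon X⅋ Y\to B_1$, $k\colon A_2\to B_2$, $$\Phi(g,\,\mathrm{id}_Y\otimes k)\circ\delta_R\circ(f\otimes\mathrm{id}_{A_2})=(g\circ f)\otimes k\colon A_1\otimes A_2\to B_1\otimes B_2;$$ together with their symmetric (left-right mirrored) analogues: 3. for all $h\colon A_1\to X\otimes Y$, $k\colon X\otimes Y\to B_1$, $f\colon A_2\to B_2$, $$(k⅋\mathrm{id}_{B_2})\circ\delta_L\circ\Phi'(h,\,\mathrm{id}_Y⅋ f)=(k\circ h)⅋ f;$$ 4. for all $k\colon A_1\to B_1$, $f\colon A_2\to X⅋ Y$, $g\colon X⅋ Y\to B_2$, $$\Phi'(k\otimes\mathrm{id}_X,\,g)\circ\delta_L\circ(\mathrm{id}_{A_1}\otimes f)=k\otimes(g\circ f).$$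 Then $\mathcal C$ is autonomous, i.e. every object of $(\mathcal C,\otimes,I)$ has a left and a right dual.
   Context: Here $⅋$ is simply a symbol for the ''par'' tensor of a $*$-autonomous category (the upside-down ampersand of linear logic). **$*$-autonomous categories** (non-symmetric, in the sense of Barr). A $*$-autonomous category is a monoidal category $(\mathcal C,\otimes,I)$ with an object $\bot$ such that there are contravariant equivalences $(-)^*,{}^*(-)\colon\mathcal C^{\mathrm{op}}\to\mathcal C$, inverse to each other (${}^*(A^* )\cong A\cong({}^*A)^*$), with natural bijections $\mathcal C(A\otimes B,\bot)\cong\mathcal C(B,A^* )\cong\mathcal C(A,{}^*B)$, and $\mathcal C$ is biclosed in the corresponding way. The par tensor is $A⅋ B={}^*(B^*\otimes A^* )\cong({}^*B\otimes{}^*A)^*$; it is a monoidal structure with unit $\bot$, and $(A⅋ B)^*\cong B^*\otimes A^*$, ${}^*(A⅋ B)\cong{}^*B\otimes{}^*A$ coherently. The linear distributors are the canonical natural maps $$\delta_L\colon A\otimes(B⅋ D)\to(A\otimes B)⅋ D,\qquad\delta_R\colon(A⅋ B)\otimes D\to A⅋(B\otimes D).$$ There are natural bijections $\mathcal C(A\otimes B,D)\cong\mathcal C(A,D⅋{}^*B)$ and $\mathcal C(B\otimes A,D)\cong\mathcal C(A,B^*⅋ D)$, with counits and units $$\mathsf{ev}_{A,B}\colon(A⅋{}^*B)\otimes B\to A,\quad\mathsf{coev}_{A,B}\colon A\to(A\otimes B)⅋{}^*B,$$ $$\mathsf{ev}'_{A,B}\colon B\otimes(B^*⅋ A)\to A,\quad\mathsf{coev}'_{A,B}\colon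 A\to B^*⅋(B\otimes A).$$ A category is Cauchy complete if all its idempotents split. **Right and left $\otimes$-traces.** With $\alpha_{A,B,D}\colon(A\otimes B)\otimes D\to A\otimes(B\otimes D)$ and $\rho$ the right unitor, a right $\otimes$-trace is a family of maps $\mathsf{RTr}_\otimes^X\colon\mathcal C(A\otimes X,B\otimes X)\to\mathcal C(A,B)$ such that - $\mathsf{RTr}_\otimes^X((g\otimes\mathrm{id}_X)\circ h\circ(f\otimes\mathrm{id}_X))=g\circ\mathsf{RTr}_\otimes^X(h)\circ f$ for $f\colon A\to A'$, $h\colon A'\otimes X\to B\otimes X$, $g\colon B\to B'$; - $\mathsf{RTr}_\otimes^{X'}((\mathrm{id}_B\otimes p)\circ h)=\mathsf{RTr}_\otimes^X(h\circ(\mathrm{id}_A\otimes p))$ for $p\colon X\to X'$, $h\colon A\otimes X'\to B\otimes X$; - $\mathsf{RTr}_\otimes^I(f)=\rho_B\circ f\circ\rho_A^{-1}$ for $f\colon A\otimes I\to B\otimes I$; - $\mathsf{RTr}_\otimes^X(\mathsf{RTr}_\otimes^Y(f))=\mathsf{RTr}_\otimes^{X\otimes Y}(\alpha_{B,X,Y}\circ f\circ\alpha^{-1}_{A,X,Y})$ for $f\colon(A\otimes X)\otimes Y\to(B\otimes X)\otimes Y$; - $g\otimes\mathsf{RTr}_\otimes^X(f)=\mathsf{RTr}_\otimes^X(\alpha^{-1}_{E,B,X}\circ(g\otimes f)\circ\alpha_{D,A,X})$ for $g\colon D\to E$, $f\colon A\otimes X\to B\otimes X$. A left $\otimes$-trace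 is the mirror image: a family $\mathsf{LTr}_\otimes^X\colon\mathcal C(X\otimes A,X\otimes B)\to\mathcal C(A,B)$ which is a right trace for the reversed tensor $A\otimes^{\mathrm{rev}}B=B\otimes A$. No compatibility between the left and the right trace is assumed. **Derived $⅋$-traces.** Transporting along the duality, the left $\otimes$-trace induces a right $⅋$-trace $\mathsf{RTr}_{⅋}^V\colon\mathcal C(A⅋ V,B⅋ V)\to\mathcal C(A,B)$, where $\mathsf{RTr}_{⅋}^V(f)$ is the unique morphism with $$(\mathsf{RTr}_{⅋}^V(f))^*=\mathsf{LTr}_\otimes^{V^*}\bigl(V^*\otimes B^*\cong(B⅋ V)^*\xrightarrow{f^*}(A⅋ V)^*\cong V^*\otimes A^*\bigr),$$ and the right $\otimes$-trace induces a left $⅋$-trace $\mathsf{LTr}_{⅋}^V\colon\mathcal C(V⅋ A,V⅋ B)\to\mathcal C(A,B)$, where $\mathsf{LTr}_{⅋}^V(f)$ is the unique morphism with $${}^*(\mathsf{LTr}_{⅋}^V(f))=\mathsf{RTr}_\otimes^{{}^*V}\bigl({}^*B\otimes{}^*V\cong{}^*(V⅋ B)\xrightarrow{{}^*f}{}^*(V⅋ A)\cong{}^*A\otimes{}^*V\bigr).$$ **White Frobenius operations.** For $g\colon A_1⅋ Z\to B_1$ and $h\colon A_2\to Z\otimes B_2$, define $\Phi(g,h)\colon A_1⅋ A_2\to B_1\otimes B_2$ by $$\Phi(g,h)=\mathsf{RTr}_{⅋}^{{}^*B_2}\Bigl((A_1⅋ A_2)⅋{}^*B_2\cong A_1⅋(A_2⅋{}^*B_2)\xrightarrow{\mathrm{id}\,⅋\,t}A_1⅋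 Z\xrightarrow{g}B_1\xrightarrow{\mathsf{coev}_{B_1,B_2}}(B_1\otimes B_2)⅋{}^*B_2\Bigr),$$ where $t=\mathsf{RTr}_\otimes^{B_2}\bigl((A_2⅋{}^*B_2)\otimes B_2\xrightarrow{\mathsf{ev}_{A_2,B_2}}A_2\xrightarrow{h}Z\otimes B_2\bigr)\colon A_2⅋{}^*B_2\to Z$. Symmetrically, for $h\colon A_1\to B_1\otimes Z$ and $g\colon Z⅋ A_2\to B_2$, define $\Phi'(h,g)\colon A_1⅋ A_2\to B_1\otimes B_2$ by $$\Phi'(h,g)=\mathsf{LTr}_{⅋}^{B_1^*}\Bigl(B_1^*⅋(A_1⅋ A_2)\cong(B_1^*⅋ A_1)⅋ A_2\xrightarrow{t'\,⅋\,\mathrm{id}}Z⅋ A_2\xrightarrow{g}B_2\xrightarrow{\mathsf{coev}'_{B_2,B_1}}B_1^*⅋(B_1\otimes B_2)\Bigr),$$ where $t'=\mathsf{LTr}_\otimes^{B_1}\bigl(B_1\otimes(B_1^*⅋ A_1)\xrightarrow{\mathsf{ev}'_{A_1,B_1}}A_1\xrightarrow{h}B_1\otimes Z\bigr)\colon B_1^*⅋ A_1\to Z$. *)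

(* Defs.v *)
(** Non-symmetric star-autonomous categories, traces and the white Frobenius
    operations.  Plain Rocq; hom-sets are types with Leibniz equality. *)

From Stdlib Require Import Setoid.

Set Implicit Arguments.
Unset Strict Implicit.
Unset Printing Implicit Defensive.

Declare Scope cat_scope.
Delimit Scope cat_scope with cat.
Open Scope cat_scope.

Record Category := {
  ob :> Type;
  hom : ob -> ob -> Type;
  id : forall A, hom A A;
  comp : forall A B D, hom B D -> hom A B -> hom A D;
  comp_id_l : forall A B (f : hom A B), comp (id B) f = f;
  comp_id_r : forall A B (f : hom A B), comp f (id A) = f;
  comp_assoc : forall A B D E (h : hom D E) (g : hom B D) (f : hom A B),
    comp (comp h g) f = comp h (comp g f)
}.
Arguments hom {c} A B.
Arguments id {c} A.
Arguments comp {c A B D} g f.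

Notation "g ∘ f" := (comp g f) (at level 40, left associativity) : cat_scope.

Record Iso (C : Category) (A B : C) := {
  fwd :> hom A B;
  bwd : hom B A;
  bwd_fwd : bwd ∘ fwd = id A;
  fwd_bwd : fwd ∘ bwd = id B
}.

Definition iso_inv (C : Category) (A B : C) (i : Iso A B) : Iso B A :=
  {| fwd := bwd i; bwd := fwd i; bwd_fwd := fwd_bwd i; fwd_bwd := bwd_fwd i |}.

Definition cauchy_complete (C : Category) : Prop :=
  forall (A : C) (e : hom A A), e ∘ e = e ->
  exists (B : C) (r : hom A B) (s : hom B A), s ∘ r = e /\ r ∘ s = id B.

Record Monoidal := {
  cat :> Category;
  tens : cat -> cat -> cat;
  tens_map : forall (A A' B B' : cat),
    hom A A' -> hom B B' -> hom (tens A B) (tens A' B');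
  unit : cat;
  assoc : forall A B D : cat, Iso (tens (tens A B) D) (tens A (tens B D));
  lunit : forall A : cat, Iso (tens unit A) A;
  runit : forall A : cat, Iso (tens A unit) A;
  tens_id : forall A B : cat, tens_map (id A) (id B) = id (tens A B);
  tens_comp : forall (A A' A'' B B' B'' : cat)
    (f' : hom A' A'') (f : hom A A') (g' : hom B' B'') (g : hom B B'),
    tens_map (f' ∘ f) (g' ∘ g) = tens_map f' g' ∘ tens_map f g;
  assoc_nat : forall (A A' B B' D D' : cat)
    (f : hom A A') (g : hom B B') (h : hom D D'),
    assoc A' B' D' ∘ tens_map (tens_map f g) h
    = tens_map f (tens_map g h) ∘ assoc A B D;
  lunit_nat : forall (A A' : cat) (f : hom A A'),
    lunit A' ∘ tens_map (id unit) f = f ∘ lunit A;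
  runit_nat : forall (A A' : cat) (f : hom A A'),
    runit A' ∘ tens_map f (id unit) = f ∘ runit A;
  triangle : forall A B : cat,
    tens_map (id A) (lunit B) ∘ assoc A unit B = tens_map (runit A) (id B);
  pentagon : forall A B D E : cat,
    assoc A B (tens D E) ∘ assoc (tens A B) D E
    = tens_map (id A) (assoc B D E) ∘ assoc A (tens B D) E
      ∘ tens_map (assoc A B D) (id E)
}.
Arguments tens {m} A B.
Arguments tens_map {m A A' B B'} f g.
Arguments unit {m}.
Arguments assoc {m} A B D.
Arguments lunit {m} A.
Arguments runit {m} A.

Notation "A ⊗ B" := (tens A B) (at level 36, left associativity) : cat_scope.
Notation "f ⊗₁ g" := (tens_map f g) (at level 36, left associativity) : cat_scope.

Section Reverse.
Variable C : Monoidal.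

Lemma rev_assoc_nat (A A' B B' D D' : C)
  (f : hom A A') (g : hom B B') (h : hom D D') :
  bwd (assoc D' B' A') ∘ (h ⊗₁ (g ⊗₁ f)) = ((h ⊗₁ g) ⊗₁ f) ∘ bwd (assoc D B A).
Proof.
rewrite <- (comp_id_r (bwd _ ∘ _)), <- (fwd_bwd (assoc D B A)).
rewrite <- (comp_assoc (bwd (assoc D' B' A') ∘ _)), (comp_assoc (bwd _)).
rewrite <- assoc_nat, <- (comp_assoc (bwd _)), bwd_fwd, comp_id_l.
reflexivity.
Qed.

Lemma rev_triangle (A B : C) :
  (runit B ⊗₁ id A) ∘ bwd (assoc B unit A) = id B ⊗₁ lunit A.
Proof.
rewrite <- triangle, comp_assoc, fwd_bwd, comp_id_r; reflexivity.
Qed.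

Lemma rev_pentagon (A B D E : C) :
  bwd (assoc (E ⊗ D) B A) ∘ bwd (assoc E D (B ⊗ A))
  = (bwd (assoc E D B) ⊗₁ id A) ∘ bwd (assoc E (D ⊗ B) A)
    ∘ (id E ⊗₁ bwd (assoc D B A)).
Proof.
set (l := bwd _ ∘ bwd _); set (r := _ ∘ (id E ⊗₁ _)).
set (m := assoc E D (B ⊗ A) ∘ assoc (E ⊗ D) B A).
assert (lm : l ∘ m = id _).
{ unfold l, m; rewrite comp_assoc, <- (comp_assoc (bwd (assoc E D _))).
  rewrite bwd_fwd, comp_id_l, bwd_fwd; reflexivity. }
assert (mr : m ∘ r = id _).
{ unfold m, r; rewrite pentagon, !comp_assoc.
  rewrite <- (comp_assoc (assoc E D B ⊗₁ id A)), <- tens_comp, fwd_bwd.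
  rewrite comp_id_l, tens_id, comp_id_l, <- (comp_assoc (assoc E (D ⊗ B) A)).
  rewrite fwd_bwd, comp_id_l, <- tens_comp, fwd_bwd, comp_id_l, tens_id.
  reflexivity. }
rewrite <- (comp_id_r l), <- mr, <- comp_assoc, lm, comp_id_l; reflexivity.
Qed.

(** The same category with the reversed tensor [A ⊗rev B := B ⊗ A]. *)
Definition rev : Monoidal := {|
  cat := C;
  tens := fun A B => B ⊗ A;
  tens_map := fun A A' B B' f g => g ⊗₁ f;
  unit := unit;
  assoc := fun A B D => iso_inv (assoc D B A);
  lunit := fun A => runit A;
  runit := fun A => lunit A;
  tens_id := fun A B => tens_id B A;
  tens_comp := fun A A' A'' B B' B'' f' f g' g => tens_comp g' g f' f;
  assoc_nat := rev_assoc_nat;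
  lunit_nat := @runit_nat C;
  runit_nat := @lunit_nat C;
  triangle := rev_triangle;
  pentagon := rev_pentagon
|}.

End Reverse.

Definition is_dual_pair (C : Monoidal) (L R : C)
    (eta : hom unit (R ⊗ L)) (eps : hom (L ⊗ R) unit) : Prop :=
  runit R ∘ (id R ⊗₁ eps) ∘ assoc R L R ∘ (eta ⊗₁ id R) ∘ bwd (lunit R) = id R
  /\ lunit L ∘ (eps ⊗₁ id L) ∘ bwd (assoc L R L) ∘ (id L ⊗₁ eta) ∘ bwd (runit L)
     = id L.

Definition has_right_dual (C : Monoidal) (A : C) : Prop :=
  exists (B : C) (eta : hom unit (B ⊗ A)) (eps : hom (A ⊗ B) unit),
    is_dual_pair eta eps.

Definition has_left_dual (C : Monoidal) (A : C) : Prop :=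
  exists (B : C) (eta : hom unit (A ⊗ B)) (eps : hom (B ⊗ A) unit),
    is_dual_pair eta eps.

Definition autonomous (C : Monoidal) : Prop :=
  forall A : C, has_left_dual A /\ has_right_dual A.

Record RightTrace (C : Monoidal) := {
  rtr :> forall X A B : C, hom (A ⊗ X) (B ⊗ X) -> hom A B;
  rtr_natural : forall (X A A' B B' : C)
    (f : hom A A') (h : hom (A' ⊗ X) (B ⊗ X)) (g : hom B B'),
    rtr ((g ⊗₁ id X) ∘ h ∘ (f ⊗₁ id X)) = g ∘ rtr h ∘ f;
  rtr_dinatural : forall (X X' A B : C)
    (p : hom X X') (h : hom (A ⊗ X') (B ⊗ X)),
    rtr ((id B ⊗₁ p) ∘ h) = rtr (h ∘ (id A ⊗₁ p));
  rtr_unit : forall (A B : C) (f : hom (A ⊗ unit) (B ⊗ unit)),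
    rtr f = runit B ∘ f ∘ bwd (runit A);
  rtr_tensor : forall (X Y A B : C) (f : hom ((A ⊗ X) ⊗ Y) ((B ⊗ X) ⊗ Y)),
    rtr (rtr f) = rtr (assoc B X Y ∘ f ∘ bwd (assoc A X Y));
  rtr_superpose : forall (X A B D E : C)
    (g : hom D E) (f : hom (A ⊗ X) (B ⊗ X)),
    g ⊗₁ rtr f = rtr (bwd (assoc E B X) ∘ (g ⊗₁ f) ∘ assoc D A X)
}.
Arguments rtr {C} r X {A B} f.

Definition LeftTrace (C : Monoidal) := RightTrace (rev C).

Definition ltr (C : Monoidal) (T : LeftTrace C) (X : C) (A B : C)
  (f : hom (X ⊗ A) (X ⊗ B)) : hom A B := @rtr (rev C) T X A B f.
Arguments ltr {C} T X {A B} f.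

(** [rstar A] is the right-hand dual (exponent star on the right of [A]) and
    [lstar A] the left-hand one.  The two bijections [rcurry] and [lcurry] being
    natural, the two star functors are adjoint on the right, and [ldn], [rdn]
    ask for the units of that adjunction to be invertible: the functors are
    then contravariant equivalences, inverse to each other.  Biclosedness is a
    consequence; the internal homs are [D ⅋ lstar B] and [rstar B ⅋ D], see
    [curryK], [uncurryK], [curryK'] and [uncurryK']. *)

Record StarAutonomous := {
  mon :> Monoidal;
  bot : mon;
  rstar : mon -> mon;
  lstar : mon -> mon;
  rstar_map : forall A B : mon, hom A B -> hom (rstar B) (rstar A);
  lstar_map : forall A B : mon, hom A B -> hom (lstar B) (lstar A);
  rstar_id : forall A : mon, rstar_map (id A) = id (rstar A);
  lstar_id : forall A : mon, lstar_map (id A) = id (lstar A);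
  rstar_comp : forall (A B D : mon) (g : hom B D) (f : hom A B),
    rstar_map (g ∘ f) = rstar_map f ∘ rstar_map g;
  lstar_comp : forall (A B D : mon) (g : hom B D) (f : hom A B),
    lstar_map (g ∘ f) = lstar_map f ∘ lstar_map g;
  rcurry : forall A B : mon, hom (A ⊗ B) bot -> hom B (rstar A);
  runcurry : forall A B : mon, hom B (rstar A) -> hom (A ⊗ B) bot;
  lcurry : forall A B : mon, hom (A ⊗ B) bot -> hom A (lstar B);
  luncurry : forall A B : mon, hom A (lstar B) -> hom (A ⊗ B) bot;
  rcurryK : forall (A B : mon) (f : hom (A ⊗ B) bot), runcurry (rcurry f) = f;
  runcurryK : forall (A B : mon) (g : hom B (rstar A)), rcurry (runcurry g) = g;
  lcurryK : forall (A B : mon) (f : hom (A ⊗ B) bot), luncurry (lcurry f) = f;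
  luncurryK : forall (A B : mon) (g : hom A (lstar B)), lcurry (luncurry g) = g;
  rcurry_nat : forall (A A' B B' : mon)
    (f : hom (A ⊗ B) bot) (a : hom A' A) (b : hom B' B),
    rcurry (f ∘ (a ⊗₁ b)) = rstar_map a ∘ rcurry f ∘ b;
  lcurry_nat : forall (A A' B B' : mon)
    (f : hom (A ⊗ B) bot) (a : hom A' A) (b : hom B' B),
    lcurry (f ∘ (a ⊗₁ b)) = lstar_map b ∘ lcurry f ∘ a;
  ldn : forall A : mon, Iso A (lstar (rstar A));
  rdn : forall A : mon, Iso A (rstar (lstar A));
  ldnE : forall A : mon, fwd (ldn A) = lcurry (runcurry (id (rstar A)));
  rdnE : forall A : mon, fwd (rdn A) = rcurry (luncurry (id (lstar A)))
}.
Arguments bot {s}.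
Arguments rstar {s} A.
Arguments lstar {s} A.
Arguments rstar_map {s A B} f.
Arguments lstar_map {s A B} f.
Arguments rcurry {s A B} f.
Arguments runcurry {s A B} g.
Arguments lcurry {s A B} f.
Arguments luncurry {s A B} g.
Arguments ldn {s} A.
Arguments rdn {s} A.

Section Par.
Variable C : StarAutonomous.

Definition rpair (A : C) : hom (A ⊗ rstar A) bot := runcurry (id (rstar A)).
Definition lpair (A : C) : hom (lstar A ⊗ A) bot := luncurry (id (lstar A)).

Definition par (A B : C) : C := lstar (rstar B ⊗ rstar A).

Definition par_map (A A' B B' : C) (f : hom A A') (g : hom B B') :
  hom (par A B) (par A' B') := lstar_map (rstar_map g ⊗₁ rstar_map f).

Notation "A ⅋ B" := (par A B) (at level 37, left associativity) : cat_scope.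
Notation "f ⅋₁ g" := (par_map f g) (at level 37, left associativity) : cat_scope.

(** C(W ⊗ B^*, A) = C((W ⊗ B^* ) ⊗ A^*, bot) = C(W ⊗ (B^* ⊗ A^* ), bot)
    = C(W, A ⅋ B). *)
Definition par_rcurry (W A B : C) (f : hom (W ⊗ rstar B) A) : hom W (A ⅋ B) :=
  lcurry (rpair A ∘ (f ⊗₁ id (rstar A)) ∘ bwd (assoc W (rstar B) (rstar A))).

Definition par_runcurry (W A B : C) (g : hom W (A ⅋ B)) : hom (W ⊗ rstar B) A :=
  bwd (ldn A) ∘ lcurry (luncurry g ∘ assoc W (rstar B) (rstar A)).

(** C( *A ⊗ W, B) = C(( *A ⊗ W) ⊗ B^*, bot) = C( *A ⊗ (W ⊗ B^* ), bot)
    = C(W ⊗ B^*, A) = C(W, A ⅋ B). *)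
Definition par_lcurry (W A B : C) (f : hom (lstar A ⊗ W) B) : hom W (A ⅋ B) :=
  par_rcurry (bwd (rdn A)
    ∘ rcurry (rpair B ∘ (f ⊗₁ id (rstar B)) ∘ bwd (assoc (lstar A) W (rstar B)))).

Definition par_luncurry (W A B : C) (g : hom W (A ⅋ B)) : hom (lstar A ⊗ W) B :=
  bwd (ldn B)
    ∘ lcurry (lpair A ∘ (id (lstar A) ⊗₁ par_runcurry g)
              ∘ assoc (lstar A) W (rstar B)).

(** The bijections C(A ⊗ B, D) = C(A, D ⅋ *B) and C(B ⊗ A, D) = C(A, B^* ⅋ D). *)
Definition curry (A B D : C) (f : hom (A ⊗ B) D) : hom A (D ⅋ lstar B) :=
  par_rcurry (f ∘ (id A ⊗₁ bwd (rdn B))).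
Definition uncurry (A B D : C) (g : hom A (D ⅋ lstar B)) : hom (A ⊗ B) D :=
  par_runcurry g ∘ (id A ⊗₁ rdn B).
Definition curry' (A B D : C) (f : hom (B ⊗ A) D) : hom A (rstar B ⅋ D) :=
  par_lcurry (f ∘ (bwd (ldn B) ⊗₁ id A)).
Definition uncurry' (A B D : C) (g : hom A (rstar B ⅋ D)) : hom (B ⊗ A) D :=
  par_luncurry g ∘ (ldn B ⊗₁ id A).

Definition ev (A B : C) : hom ((A ⅋ lstar B) ⊗ B) A := uncurry (id (A ⅋ lstar B)).
Definition coev (A B : C) : hom A ((A ⊗ B) ⅋ lstar B) := curry (id (A ⊗ B)).
Definition ev' (A B : C) : hom (B ⊗ (rstar B ⅋ A)) A := uncurry' (id (rstar B ⅋ A)).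
Definition coev' (A B : C) : hom A (rstar B ⅋ (B ⊗ A)) := curry' (id (B ⊗ A)).

(** Transposes of (A ⊗ (B ⅋ D)) ⊗ D^* -> A ⊗ ((B ⅋ D) ⊗ D^* ) -> A ⊗ B and of
    *A ⊗ ((A ⅋ B) ⊗ D) -> ( *A ⊗ (A ⅋ B)) ⊗ D -> B ⊗ D. *)
Definition distL (A B D : C) : hom (A ⊗ (B ⅋ D)) ((A ⊗ B) ⅋ D) :=
  par_rcurry ((id A ⊗₁ par_runcurry (id (B ⅋ D))) ∘ assoc A (B ⅋ D) (rstar D)).
Definition distR (A B D : C) : hom ((A ⅋ B) ⊗ D) (A ⅋ (B ⊗ D)) :=
  par_lcurry ((par_luncurry (id (A ⅋ B)) ⊗₁ id D) ∘ bwd (assoc (lstar A) (A ⅋ B) D)).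

Lemma tens_split (A A' B B' : C) (f : hom A A') (g : hom B B') :
  (f ⊗₁ id B') ∘ (id A ⊗₁ g) = f ⊗₁ g.
Proof. rewrite <- tens_comp, comp_id_l, comp_id_r; reflexivity. Qed.

Lemma tens_split' (A A' B B' : C) (f : hom A A') (g : hom B B') :
  (id A' ⊗₁ g) ∘ (f ⊗₁ id B) = f ⊗₁ g.
Proof. rewrite <- tens_comp, comp_id_l, comp_id_r; reflexivity. Qed.

Lemma rcurryE (A B : C) (f : hom (A ⊗ B) bot) :
  rpair A ∘ (id A ⊗₁ rcurry f) = f.
Proof.
rewrite <- (rcurryK f) at 2; rewrite <- (rcurryK (rpair A ∘ _)), rcurry_nat.
unfold rpair; rewrite runcurryK, rstar_id, !comp_id_l; reflexivity.
Qed.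

Lemma lcurryE (A B : C) (f : hom (A ⊗ B) bot) :
  lpair B ∘ (lcurry f ⊗₁ id B) = f.
Proof.
rewrite <- (lcurryK f) at 2; rewrite <- (lcurryK (lpair B ∘ _)), lcurry_nat.
unfold lpair; rewrite luncurryK, lstar_id, !comp_id_l; reflexivity.
Qed.

Lemma rcurry_natr (A B B' : C) (f : hom (A ⊗ B) bot) (b : hom B' B) :
  rcurry (f ∘ (id A ⊗₁ b)) = rcurry f ∘ b.
Proof. rewrite rcurry_nat, rstar_id, comp_id_l; reflexivity. Qed.

Lemma lcurry_natl (A A' B : C) (f : hom (A ⊗ B) bot) (a : hom A' A) :
  lcurry (f ∘ (a ⊗₁ id B)) = lcurry f ∘ a.
Proof. rewrite lcurry_nat, lstar_id, comp_id_l; reflexivity. Qed.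

Lemma ldn_pair (A B : C) (f : hom B A) :
  lcurry (rpair A ∘ (f ⊗₁ id (rstar A))) = ldn A ∘ f.
Proof. rewrite lcurry_nat, lstar_id, comp_id_l, ldnE; reflexivity. Qed.

Lemma rdn_pair (A B : C) (f : hom B A) :
  rcurry (lpair A ∘ (id (lstar A) ⊗₁ f)) = rdn A ∘ f.
Proof. rewrite rcurry_nat, rstar_id, comp_id_l, rdnE; reflexivity. Qed.

Lemma ldn_bwd (A B : C) (f : hom (B ⊗ rstar A) bot) :
  rpair A ∘ ((bwd (ldn A) ∘ lcurry f) ⊗₁ id (rstar A)) = f.
Proof.
rewrite <- (lcurryK (rpair A ∘ _)), ldn_pair, <- comp_assoc, fwd_bwd, comp_id_l.
apply lcurryK.
Qed.

Lemma rdn_bwd (A B : C) (f : hom (lstar A ⊗ B) bot) :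
  lpair A ∘ (id (lstar A) ⊗₁ (bwd (rdn A) ∘ rcurry f)) = f.
Proof.
rewrite <- (rcurryK (lpair A ∘ _)), rdn_pair, <- comp_assoc, fwd_bwd, comp_id_l.
apply rcurryK.
Qed.

Lemma par_rcurryK (W A B : C) (f : hom (W ⊗ rstar B) A) :
  par_runcurry (par_rcurry f) = f.
Proof.
unfold par_runcurry, par_rcurry.
rewrite lcurryK, comp_assoc, bwd_fwd, comp_id_r, ldn_pair, <- comp_assoc.
rewrite bwd_fwd, comp_id_l; reflexivity.
Qed.

Lemma par_runcurryK (W A B : C) (g : hom W (A ⅋ B)) :
  par_rcurry (par_runcurry g) = g.
Proof.
unfold par_runcurry, par_rcurry.
rewrite ldn_bwd, comp_assoc, fwd_bwd, comp_id_r, luncurryK; reflexivity.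
Qed.

Lemma par_lcurryK (W A B : C) (f : hom (lstar A ⊗ W) B) :
  par_luncurry (par_lcurry f) = f.
Proof.
unfold par_luncurry, par_lcurry.
rewrite par_rcurryK, rdn_bwd, comp_assoc, bwd_fwd, comp_id_r, ldn_pair.
rewrite <- comp_assoc, bwd_fwd, comp_id_l; reflexivity.
Qed.

Lemma par_luncurryK (W A B : C) (g : hom W (A ⅋ B)) :
  par_lcurry (par_luncurry g) = g.
Proof.
unfold par_luncurry, par_lcurry.
rewrite ldn_bwd, comp_assoc, fwd_bwd, comp_id_r, rdn_pair, <- comp_assoc.
rewrite bwd_fwd, comp_id_l; apply par_runcurryK.
Qed.

Lemma curryK (A B D : C) (f : hom (A ⊗ B) D) : uncurry (curry f) = f.
Proof.
unfold uncurry, curry; rewrite par_rcurryK, comp_assoc, <- tens_comp.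
rewrite bwd_fwd, comp_id_l, tens_id, comp_id_r; reflexivity.
Qed.

Lemma uncurryK (A B D : C) (g : hom A (D ⅋ lstar B)) : curry (uncurry g) = g.
Proof.
unfold uncurry, curry; rewrite comp_assoc, <- tens_comp.
rewrite fwd_bwd, comp_id_l, tens_id, comp_id_r; apply par_runcurryK.
Qed.

Lemma curryK' (A B D : C) (f : hom (B ⊗ A) D) : uncurry' (curry' f) = f.
Proof.
unfold uncurry', curry'; rewrite par_lcurryK, comp_assoc, <- tens_comp.
rewrite bwd_fwd, comp_id_l, tens_id, comp_id_r; reflexivity.
Qed.

Lemma uncurryK' (A B D : C) (g : hom A (rstar B ⅋ D)) : curry' (uncurry' g) = g.
Proof.
unfold uncurry', curry'; rewrite comp_assoc, <- tens_comp.
rewrite fwd_bwd, comp_id_l, tens_id, comp_id_r; apply par_luncurryK.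
Qed.

Lemma par_rcurry_nat (W W' A B : C) (f : hom (W ⊗ rstar B) A) (w : hom W' W) :
  par_rcurry (f ∘ (w ⊗₁ id (rstar B))) = par_rcurry f ∘ w.
Proof.
unfold par_rcurry.
rewrite <- (comp_id_l (id (rstar A))) at 1; rewrite tens_comp.
rewrite !comp_assoc, <- (rev_assoc_nat (id (rstar A)) (id (rstar B)) w).
rewrite tens_id, <- !comp_assoc, lcurry_nat, lstar_id, comp_id_l; reflexivity.
Qed.

Lemma par_lcurry_nat (W W' A B : C) (f : hom (lstar A ⊗ W) B) (w : hom W' W) :
  par_lcurry (f ∘ (id (lstar A) ⊗₁ w)) = par_lcurry f ∘ w.
Proof.
unfold par_lcurry; rewrite <- par_rcurry_nat; f_equal.
rewrite <- (comp_id_l (id (rstar B))) at 1; rewrite tens_comp.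
rewrite !comp_assoc, <- (rev_assoc_nat (id (rstar B)) w (id (lstar A))).
rewrite <- !comp_assoc, rcurry_nat, rstar_id, comp_id_l, !comp_assoc; reflexivity.
Qed.

Lemma evE (A B D : C) (g : hom A (D ⅋ lstar B)) : ev D B ∘ (g ⊗₁ id B) = uncurry g.
Proof.
unfold ev, uncurry; rewrite comp_assoc, <- tens_comp, comp_id_l, comp_id_r.
rewrite <- (tens_split g (rdn B)), <- comp_assoc; f_equal.
rewrite <- (par_rcurryK (_ ∘ _)), par_rcurry_nat, par_runcurryK, comp_id_l.
reflexivity.
Qed.

Lemma evE' (A B D : C) (g : hom A (rstar B ⅋ D)) :
  ev' D B ∘ (id B ⊗₁ g) = uncurry' g.
Proof.
unfold ev', uncurry'.
rewrite comp_assoc, (tens_split (ldn B) g), <- tens_split', <- comp_assoc; f_equal.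
rewrite <- (par_lcurryK (_ ∘ _)), par_lcurry_nat, par_luncurryK, comp_id_l.
reflexivity.
Qed.

Definition rstar_iso (A B : C) (i : Iso A B) : Iso (rstar B) (rstar A).
Proof.
refine {| fwd := rstar_map i; bwd := rstar_map (bwd i) |};
  rewrite <- rstar_comp; [rewrite fwd_bwd | rewrite bwd_fwd]; apply rstar_id.
Defined.

Definition lstar_iso (A B : C) (i : Iso A B) : Iso (lstar B) (lstar A).
Proof.
refine {| fwd := lstar_map i; bwd := lstar_map (bwd i) |};
  rewrite <- lstar_comp; [rewrite fwd_bwd | rewrite bwd_fwd]; apply lstar_id.
Defined.

Definition tens_iso (A A' B B' : C) (i : Iso A A') (j : Iso B B') :
  Iso (A ⊗ B) (A' ⊗ B').
Proof.
refine {| fwd := i ⊗₁ j; bwd := bwd i ⊗₁ bwd j |};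
  rewrite <- tens_comp, ?bwd_fwd, ?fwd_bwd; apply tens_id.
Defined.

Definition iso_id (A : C) : Iso A A :=
  {| fwd := id A; bwd := id A;
     bwd_fwd := comp_id_l (id A); fwd_bwd := comp_id_l (id A) |}.

Definition iso_comp (A B D : C) (j : Iso B D) (i : Iso A B) : Iso A D.
Proof.
refine {| fwd := j ∘ i; bwd := bwd i ∘ bwd j |}.
- rewrite comp_assoc, <- (comp_assoc (bwd j)), bwd_fwd, comp_id_l; apply bwd_fwd.
- rewrite comp_assoc, <- (comp_assoc i), fwd_bwd, comp_id_l; apply fwd_bwd.
Defined.

(** (A ⅋ B)^* = ( *(B^* ⊗ A^* ))^* = B^* ⊗ A^*. *)
Definition rstar_par (A B : C) : Iso (rstar (A ⅋ B)) (rstar B ⊗ rstar A) :=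
  iso_inv (rdn (rstar B ⊗ rstar A)).

(** The second description of par: A ⅋ B = ( *B ⊗ *A)^*. *)
Definition par_alt_fwd (A B : C) : hom (A ⅋ B) (rstar (lstar B ⊗ lstar A)) :=
  rcurry (lpair B ∘ (id (lstar B) ⊗₁ par_luncurry (id (A ⅋ B)))
          ∘ assoc (lstar B) (lstar A) (A ⅋ B)).
Definition par_alt_bwd (A B : C) : hom (rstar (lstar B ⊗ lstar A)) (A ⅋ B) :=
  par_lcurry (bwd (rdn B) ∘ rcurry (rpair (lstar B ⊗ lstar A)
    ∘ bwd (assoc (lstar B) (lstar A) (rstar (lstar B ⊗ lstar A))))).

Definition par_alt (A B : C) : Iso (A ⅋ B) (rstar (lstar B ⊗ lstar A)).
Proof.
refine {| fwd := par_alt_fwd A B; bwd := par_alt_bwd A B |};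
  unfold par_alt_fwd, par_alt_bwd.
- rewrite <- par_lcurry_nat, comp_assoc, <- rcurry_natr, comp_assoc.
  rewrite rev_assoc_nat, tens_id, <- comp_assoc, rcurryE.
  rewrite (comp_assoc _ (assoc _ _ _)), fwd_bwd, comp_id_r, rdn_pair.
  rewrite <- comp_assoc, bwd_fwd, comp_id_l; apply par_luncurryK.
- rewrite <- rcurry_natr, comp_assoc, <- tens_id, assoc_nat, <- comp_assoc.
  rewrite (comp_assoc (lpair B)), <- tens_comp, comp_id_l.
  rewrite <- (par_lcurryK (par_luncurry _ ∘ _)), par_lcurry_nat, par_luncurryK.
  rewrite comp_id_l, par_lcurryK, rdn_bwd, comp_assoc, bwd_fwd, comp_id_r.
  unfold rpair; apply runcurryK.
Defined.

(** *(A ⅋ B) = *(( *B ⊗ *A)^* ) = *B ⊗ *A. *)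
Definition lstar_par (A B : C) : Iso (lstar (A ⅋ B)) (lstar B ⊗ lstar A) :=
  iso_comp (iso_inv (ldn (lstar B ⊗ lstar A))) (lstar_iso (iso_inv (par_alt A B))).

(** Left star of the isomorphism
    (B ⅋ D)^* ⊗ A^* = (D^* ⊗ B^* ) ⊗ A^* = D^* ⊗ (B^* ⊗ A^* ) = D^* ⊗ (A ⅋ B)^*. *)
Definition par_assoc (A B D : C) : Iso ((A ⅋ B) ⅋ D) (A ⅋ (B ⅋ D)) :=
  lstar_iso
    (iso_comp (tens_iso (iso_id (rstar D)) (iso_inv (rstar_par A B)))
      (iso_comp (assoc (rstar D) (rstar B) (rstar A))
        (tens_iso (rstar_par B D) (iso_id (rstar A))))).

(** Inverses of the star functors on hom-sets: see [rstar_mapK], [rstar_unmapK],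
    [lstar_mapK] and [lstar_unmapK]. *)
Definition rstar_unmap (A B : C) (m : hom (rstar B) (rstar A)) : hom A B :=
  bwd (ldn B) ∘ lstar_map m ∘ ldn A.
Definition lstar_unmap (A B : C) (m : hom (lstar B) (lstar A)) : hom A B :=
  bwd (rdn B) ∘ rstar_map m ∘ rdn A.

Definition rtr_par (LT : LeftTrace C) (V A B : C) (f : hom (A ⅋ V) (B ⅋ V)) :
    hom A B :=
  rstar_unmap (ltr LT (rstar V)
    (rstar_par A V ∘ rstar_map f ∘ bwd (rstar_par B V))).

Definition ltr_par (RT : RightTrace C) (V A B : C) (f : hom (V ⅋ A) (V ⅋ B)) :
    hom A B :=
  lstar_unmap (rtr RT (lstar V)
    (lstar_par V A ∘ lstar_map f ∘ bwd (lstar_par V B))).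

Lemma ldn_nat (A B : C) (f : hom A B) :
  ldn B ∘ f = lstar_map (rstar_map f) ∘ ldn A.
Proof.
rewrite <- ldn_pair, ldnE, <- (comp_id_r (_ ∘ lcurry _)), <- lcurry_nat.
f_equal; rewrite <- (rcurryK (_ ∘ _)), <- (rcurryK (runcurry _ ∘ _)); f_equal.
rewrite rcurry_natr; unfold rpair; rewrite rcurry_nat, !runcurryK.
rewrite !comp_id_r, comp_id_l; reflexivity.
Qed.

Lemma rdn_nat (A B : C) (f : hom A B) :
  rdn B ∘ f = rstar_map (lstar_map f) ∘ rdn A.
Proof.
rewrite <- rdn_pair, rdnE, <- (comp_id_r (_ ∘ rcurry _)), <- rcurry_nat.
f_equal; rewrite <- (lcurryK (_ ∘ _)), <- (lcurryK (luncurry _ ∘ _)); f_equal.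
rewrite lcurry_natl; unfold lpair; rewrite lcurry_nat, !luncurryK.
rewrite !comp_id_r, comp_id_l; reflexivity.
Qed.

Lemma rstar_mapK (A B : C) (f : hom A B) : rstar_unmap (rstar_map f) = f.
Proof.
unfold rstar_unmap; rewrite comp_assoc, <- ldn_nat, <- comp_assoc, bwd_fwd.
apply comp_id_l.
Qed.

Lemma lstar_mapK (A B : C) (f : hom A B) : lstar_unmap (lstar_map f) = f.
Proof.
unfold lstar_unmap; rewrite comp_assoc, <- rdn_nat, <- comp_assoc, bwd_fwd.
apply comp_id_l.
Qed.

Lemma lstar_map_inj (A B : C) (f g : hom A B) : lstar_map f = lstar_map g -> f = g.
Proof. intro e; rewrite <- (lstar_mapK f), e; apply lstar_mapK. Qed.

Lemma rstar_map_inj (A B : C) (f g : hom A B) : rstar_map f = rstar_map g -> f = g.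
Proof. intro e; rewrite <- (rstar_mapK f), e; apply rstar_mapK. Qed.

Lemma rstar_unmapK (A B : C) (m : hom (rstar B) (rstar A)) :
  rstar_map (rstar_unmap m) = m.
Proof.
apply lstar_map_inj; rewrite <- (comp_id_r (lstar_map (rstar_map _))).
rewrite <- (fwd_bwd (ldn A)), <- comp_assoc, <- ldn_nat; unfold rstar_unmap.
rewrite !comp_assoc, fwd_bwd, comp_id_r, <- comp_assoc, fwd_bwd; apply comp_id_l.
Qed.

Lemma lstar_unmapK (A B : C) (m : hom (lstar B) (lstar A)) :
  lstar_map (lstar_unmap m) = m.
Proof.
apply rstar_map_inj; rewrite <- (comp_id_r (rstar_map (lstar_map _))).
rewrite <- (fwd_bwd (rdn A)), <- comp_assoc, <- rdn_nat; unfold lstar_unmap.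
rewrite !comp_assoc, fwd_bwd, comp_id_r, <- comp_assoc, fwd_bwd; apply comp_id_l.
Qed.

(** The equations that determine the two par-traces. *)
Lemma rtr_parE (LT : LeftTrace C) (V A B : C) (f : hom (A ⅋ V) (B ⅋ V)) :
  rstar_map (rtr_par LT f)
  = ltr LT (rstar V) (rstar_par A V ∘ rstar_map f ∘ bwd (rstar_par B V)).
Proof. apply rstar_unmapK. Qed.

Lemma ltr_parE (RT : RightTrace C) (V A B : C) (f : hom (V ⅋ A) (V ⅋ B)) :
  lstar_map (ltr_par RT f)
  = rtr RT (lstar V) (lstar_par V A ∘ lstar_map f ∘ bwd (lstar_par V B)).
Proof. apply lstar_unmapK. Qed.

Definition white (RT : RightTrace C) (LT : LeftTrace C) (A1 A2 B1 B2 Z : C)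
    (g : hom (A1 ⅋ Z) B1) (h : hom A2 (Z ⊗ B2)) : hom (A1 ⅋ A2) (B1 ⊗ B2) :=
  let t : hom (A2 ⅋ lstar B2) Z := rtr RT B2 (h ∘ ev A2 B2) in
  rtr_par LT (V := lstar B2)
    (coev B1 B2 ∘ g ∘ (id A1 ⅋₁ t) ∘ par_assoc A1 A2 (lstar B2)).

Definition white' (RT : RightTrace C) (LT : LeftTrace C) (A1 A2 B1 B2 Z : C)
    (h : hom A1 (B1 ⊗ Z)) (g : hom (Z ⅋ A2) B2) : hom (A1 ⅋ A2) (B1 ⊗ B2) :=
  let t' : hom (rstar B1 ⅋ A1) Z := ltr LT B1 (h ∘ ev' A1 B1) in
  ltr_par RT (V := rstar B1)
    (coev' B2 B1 ∘ g ∘ (t' ⅋₁ id A2) ∘ bwd (par_assoc (rstar B1) A1 A2)).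

End Par.

Arguments distL {C} A B D.
Arguments distR {C} A B D.
Arguments white {C} RT LT {A1 A2 B1 B2 Z} g h.
Arguments white' {C} RT LT {A1 A2 B1 B2 Z} h g.

Notation "A ⅋ B" := (par A B) (at level 37, left associativity) : cat_scope.
Notation "f ⅋₁ g" := (par_map f g) (at level 37, left associativity) : cat_scope.

(* Main.v *)
Require Import Defs.

(** Taking all three morphisms to be identities in the first and third
    equations shows that the linear distributors
    [distR B X Y : (B ⅋ X) ⊗ Y -> B ⅋ (X ⊗ Y)] and
    [distL X Y B : X ⊗ (Y ⅋ B) -> (X ⊗ Y) ⅋ B] have right inverses, given by
    the white Frobenius operations applied to identities.  Such sections turn
    the residuations of the star-autonomous structure into dualities.

    For the left dual of [A], take [unit ⅋ lstar A], with counit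
    [ev : (unit ⅋ lstar A) ⊗ A -> unit].  The functor [- ⊗ A] has the right
    adjoint [- ⅋ lstar A], and [distL] compares this right adjoint with tensoring by
    its value at the unit: [distL_ev] says that the adjunction counit at
    [A ⊗ unit], precomposed with [distL], is [id A ⊗ ev] up to the associator.
    A section [s] of
    [distL A unit (lstar A)] therefore lifts the adjunction unit
    [unit -> (unit ⊗ A) ⅋ lstar A], up to unitors, to
    [unit -> A ⊗ (unit ⅋ lstar A)], and the triangle identity of the adjunction
    becomes one of the two zigzag equations ([left_dual_of_distL]).

    The other zigzag equation is automatic: the zigzag endomorphism of
    [unit ⅋ lstar A] leaves the counit fixed by the first zigzag equation, and
    a map into [unit ⅋ lstar A] is determined by its transpose
    ([half_dual_pair]).  The right dual [rstar A ⅋ unit] arises in the same way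
    from [distR], the abstract part of the argument being applied to the
    reversed monoidal category. *)

Set Implicit Arguments.
Unset Strict Implicit.
Unset Printing Implicit Defensive.

(** Makes an equation between composites usable for rewriting inside a longer,
    right-nested composite. *)
Lemma chain (C : Category) (A B D : C) (g : hom B D) (f : hom A B) (k : hom A D) :
  g ∘ f = k -> forall (W : C) (w : hom W A), g ∘ (f ∘ w) = k ∘ w.
Proof. intros <- W w; symmetry; apply comp_assoc. Qed.

Lemma fwd_epi (C : Category) (A B D : C) (i : Iso A B) (f g : hom B D) :
  f ∘ i = g ∘ i -> f = g.
Proof.
intro e; rewrite <- (comp_id_r f), <- (comp_id_r g), <- (fwd_bwd i).
rewrite <- !comp_assoc, e; reflexivity.
Qed.

Lemma fwd_mono (C : Category) (A B D : C) (i : Iso A B) (f g : hom D A) :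
  i ∘ f = i ∘ g -> f = g.
Proof.
intro e; rewrite <- (comp_id_l f), <- (comp_id_l g), <- (bwd_fwd i).
rewrite !comp_assoc, e; reflexivity.
Qed.

Section Coherence.
Variable M : Monoidal.

Lemma tens_compl (A B D E : M) (g : hom B D) (f : hom A B) :
  (g ∘ f) ⊗₁ id E = (g ⊗₁ id E) ∘ (f ⊗₁ id E).
Proof. rewrite <- tens_comp, comp_id_l; reflexivity. Qed.

Lemma tens_compr (A B D E : M) (g : hom B D) (f : hom A B) :
  id E ⊗₁ (g ∘ f) = (id E ⊗₁ g) ∘ (id E ⊗₁ f).
Proof. rewrite <- tens_comp, comp_id_l; reflexivity. Qed.

Lemma interchange (A A' B B' : M) (f : hom A A') (g : hom B B') :
  (id A' ⊗₁ g) ∘ (f ⊗₁ id B) = (f ⊗₁ id B') ∘ (id A ⊗₁ g).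
Proof. rewrite <- !tens_comp, !comp_id_l, !comp_id_r; reflexivity. Qed.

Definition iso_tensl (A B E : M) (i : Iso A B) : Iso (A ⊗ E) (B ⊗ E).
Proof.
refine {| fwd := i ⊗₁ id E; bwd := bwd i ⊗₁ id E |};
  rewrite <- tens_compl, ?bwd_fwd, ?fwd_bwd; apply tens_id.
Defined.

Lemma unit_tens_faithful (A B : M) (f g : hom A B) :
  id unit ⊗₁ f = id unit ⊗₁ g -> f = g.
Proof.
intro e; apply (fwd_epi (i := lunit A)).
rewrite <- !lunit_nat, e; reflexivity.
Qed.

Lemma tens_unit_faithful (A B : M) (f g : hom A B) :
  f ⊗₁ id unit = g ⊗₁ id unit -> f = g.
Proof.
intro e; apply (fwd_epi (i := runit A)).
rewrite <- !runit_nat, e; reflexivity.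
Qed.

(** One of Kelly's redundant coherence axioms: after tensoring with the unit on
    the left, which is faithful, both sides fit in the pentagon for
    [unit, unit, A, B] together with two triangles. *)
Lemma lunit_tens (A B : M) :
  lunit (A ⊗ B) ∘ assoc unit A B = lunit A ⊗₁ id B.
Proof.
apply unit_tens_faithful.
apply (fwd_epi (i := assoc unit (unit ⊗ A) B)).
apply (fwd_epi (i := iso_tensl B (assoc unit unit A))); simpl.
rewrite <- assoc_nat, tens_compr, !comp_assoc, <- tens_compl, triangle.
rewrite assoc_nat, tens_id, <- triangle, !comp_assoc; f_equal.
rewrite pentagon, !comp_assoc; reflexivity.
Qed.

(** Tensored with the unit on the right, this is the triangle against
    [lunit_tens], once [lunit (unit ⊗ unit)] is identified with
    [id unit ⊗₁ lunit unit] by naturality of [lunit]. *)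
Lemma lunit_unit : fwd (lunit (unit : M)) = runit unit.
Proof.
apply tens_unit_faithful; rewrite <- triangle, <- lunit_tens; f_equal.
apply (fwd_mono (i := lunit unit)); symmetry; apply lunit_nat.
Qed.
End Coherence.

Lemma runit_tens (M : Monoidal) (A B : M) :
  (id A ⊗₁ runit B) ∘ assoc A B unit = runit (A ⊗ B).
Proof.
assert (e : runit (A ⊗ B) ∘ bwd (assoc A B unit) = id A ⊗₁ runit B)
  by exact (lunit_tens (M := rev M) B A).
rewrite <- e, comp_assoc, bwd_fwd; apply comp_id_r.
Qed.

(** When the identity is the only endomorphism of [L] that fixes [eps], one
    zigzag equation implies the other: substituting the zigzag endomorphism of
    [L] in [eps] gives, by bifunctoriality, [eps] applied to the zigzag of [R],
    that is [eps] itself.  The hypothesis [zigzag] is kept in the form in which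
    unitors have not yet been cancelled, which is how it comes out of an
    adjunction. *)
Lemma half_dual_pair (M : Monoidal) (L R : M)
  (eta : hom unit (R ⊗ L)) (eps : hom (L ⊗ R) unit)
  (eps_stabilizer : forall u : hom L L,
     eps ∘ (u ⊗₁ id R) = eps -> u = id L)
  (zigzag : (id R ⊗₁ eps) ∘ assoc R L R ∘ (eta ⊗₁ id R)
            = bwd (runit R) ∘ lunit R) :
  is_dual_pair eta eps.
Proof.
split.
- rewrite 2 (comp_assoc (runit R)), zigzag, <- comp_assoc.
  rewrite fwd_bwd, comp_id_l; apply fwd_bwd.
- apply eps_stabilizer.
  (* Bifunctoriality exchanges the two counits: the one of the zigzag endomorphism
     ends up last, and the one in front is applied before it, to the copy of
     [L ⊗ R] made of the last two factors. *)
  rewrite !tens_compl, !comp_assoc.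
  rewrite <- lunit_tens, !comp_assoc.
  rewrite (chain (eq_sym (lunit_nat eps))), comp_assoc, (chain (assoc_nat eps (id L) (id R))).
  rewrite !comp_assoc, tens_id, (chain (interchange eps eps)).
  (* The two unitors agree at the unit object, so the unit produced by the counit
     applied first can be absorbed on the right of [L ⊗ R], hence on the right
     of [R]; what precedes the last [eps] then becomes the zigzag of [R],
     tensored with [id L]. *)
  rewrite lunit_unit, !comp_assoc, (chain (runit_nat eps)), !comp_assoc.
  rewrite <- runit_tens, <- tens_id, !comp_assoc.
  rewrite (chain (assoc_nat (id L) (id R) eps)), !comp_assoc.
  rewrite (chain (pentagon L R L R)), !comp_assoc.
  rewrite (chain (eq_sym (tens_compl R (assoc L R L) (bwd _)))).
  rewrite fwd_bwd, tens_id, comp_id_l.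
  rewrite (chain (assoc_nat (id L) eta (id R))), !comp_assoc.
  assert (e : assoc L unit R ∘ (bwd (runit L) ⊗₁ id R) = id L ⊗₁ bwd (lunit R)).
  { rewrite <- (comp_id_l (_ ∘ _)), <- (tens_id L (unit ⊗ R)).
    rewrite <- (bwd_fwd (lunit R)), tens_compr, !comp_assoc.
    rewrite (chain (triangle L R)), <- tens_compl, fwd_bwd, tens_id.
    apply comp_id_r. }
  rewrite e, <- !tens_compr, <- (comp_assoc (id R ⊗₁ eps)).
  rewrite <- (comp_assoc (_ ∘ assoc R L R)), zigzag, !comp_assoc, fwd_bwd.
  rewrite comp_id_r, fwd_bwd, tens_id; apply comp_id_r.
Qed.

Section Distributors.
Variable C : StarAutonomous.

Lemma par_map_id (A B : C) : id A ⅋₁ id B = id (A ⅋ B).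
Proof. unfold par_map; rewrite !rstar_id, tens_id; apply lstar_id. Qed.

(** [distL] is by definition the transpose of the evaluation under [A ⊗ -]; the
    double dual isomorphism that relates [par_runcurry] to [ev] slides through
    the associator. *)
Lemma distL_ev (A D B : C) :
  ev (A ⊗ D) B ∘ (distL A D (lstar B) ⊗₁ id B)
  = (id A ⊗₁ ev D B) ∘ assoc A (D ⅋ lstar B) B.
Proof.
rewrite evE; unfold distL, ev, uncurry.
rewrite par_rcurryK, tens_compr, !comp_assoc, <- assoc_nat, tens_id; reflexivity.
Qed.

Lemma distR_ev' (B D A : C) :
  ev' (D ⊗ A) B ∘ (id B ⊗₁ distR (rstar B) D A)
  = (ev' D B ⊗₁ id A) ∘ bwd (assoc B (rstar B ⅋ D) A).
Proof.
rewrite evE'; unfold distR, ev', uncurry'.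
rewrite par_lcurryK, tens_compl, !comp_assoc, <- rev_assoc_nat, tens_id; reflexivity.
Qed.

(** With this choice of unit, the composite in the zigzag equation on [A] is the
    transpose of [distL ∘ s ∘ curry _], where the section cancels. *)
Lemma left_dual_of_distL (A : C)
  (s : hom ((A ⊗ unit) ⅋ lstar A) (A ⊗ (unit ⅋ lstar A)))
  (sK : distL A unit (lstar A) ∘ s = id _) : has_left_dual A.
Proof.
exists (unit ⅋ lstar A), (s ∘ curry (bwd (runit A) ∘ lunit A)), (ev unit A).
apply half_dual_pair.
- intros u e; rewrite evE in e.
  rewrite <- (uncurryK u), e; apply uncurryK.
- rewrite <- distL_ev, comp_assoc, <- tens_compl, <- comp_assoc, sK, comp_id_l.
  rewrite evE; apply curryK.
Qed.

(** A right dual is a left dual for the reversed tensor: the two zigzag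
    equations are the same up to their order. *)
Lemma right_dual_of_distR (A : C)
  (s : hom (rstar A ⅋ (unit ⊗ A)) ((rstar A ⅋ unit) ⊗ A))
  (sK : distR (rstar A) unit A ∘ s = id _) : has_right_dual A.
Proof.
set (eta := s ∘ curry' (bwd (lunit A) ∘ runit A)).
exists (rstar A ⅋ unit), eta, (ev' unit A).
assert (d : is_dual_pair (C := rev C) (L := rstar A ⅋ unit) (R := A) eta (ev' unit A)).
{ apply half_dual_pair; simpl.
- intros u e; rewrite evE' in e.
  rewrite <- (uncurryK' u), e; apply uncurryK'.
- rewrite <- distR_ev', comp_assoc, <- tens_compr; unfold eta.
  rewrite <- comp_assoc, sK, comp_id_l.
  rewrite evE'; apply curryK'. }
destruct d as [d1 d2]; split; assumption.
Qed.

End Distributors.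

Theorem proposition4 (C : StarAutonomous) (Ccauchy : cauchy_complete C)
  (RT : RightTrace C) (LT : LeftTrace C)
  (H1 : forall (A1 A2 B1 B2 X Y : C)
          (f : hom A1 B1) (h : hom A2 (X ⊗ Y)) (k : hom (X ⊗ Y) B2),
        (id B1 ⅋₁ k) ∘ distR B1 X Y ∘ white RT LT (f ⅋₁ id X) h = f ⅋₁ (k ∘ h))
  (H2 : forall (A1 A2 B1 B2 X Y : C)
          (f : hom A1 (X ⅋ Y)) (g : hom (X ⅋ Y) B1) (k : hom A2 B2),
        white RT LT g (id Y ⊗₁ k) ∘ distR X Y A2 ∘ (f ⊗₁ id A2) = (g ∘ f) ⊗₁ k)
  (H3 : forall (A1 A2 B1 B2 X Y : C)
          (h : hom A1 (X ⊗ Y)) (k : hom (X ⊗ Y) B1) (f : hom A2 B2),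
        (k ⅋₁ id B2) ∘ distL X Y B2 ∘ white' RT LT h (id Y ⅋₁ f) = (k ∘ h) ⅋₁ f)
  (H4 : forall (A1 A2 B1 B2 X Y : C)
          (k : hom A1 B1) (f : hom A2 (X ⅋ Y)) (g : hom (X ⅋ Y) B2),
        white' RT LT (k ⊗₁ id X) g ∘ distL A1 X Y ∘ (id A1 ⊗₁ f) = k ⊗₁ (g ∘ f)) :
  autonomous C.
Proof.
intro A; split.
- apply (left_dual_of_distL
           (s := white' RT LT (id (A ⊗ unit)) (id unit ⅋₁ id (lstar A)))).
  pose proof (H3 _ _ _ _ _ _ (id (A ⊗ unit)) (id (A ⊗ unit)) (id (lstar A))) as e.
  rewrite (comp_id_l (id (A ⊗ unit))), !par_map_id, comp_id_l in e.
  rewrite par_map_id; exact e.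
- apply (right_dual_of_distR
           (s := white RT LT (id (rstar A) ⅋₁ id unit) (id (unit ⊗ A)))).
  pose proof (H1 _ _ _ _ _ _ (id (rstar A)) (id (unit ⊗ A)) (id (unit ⊗ A))) as e.
  rewrite (comp_id_l (id (unit ⊗ A))), !par_map_id, comp_id_l in e.
  rewrite par_map_id; exact e.
Qed.
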